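(* For every integer $r\ge 3$ and all integers $n_1,\ldots,n_r\ge 2$, \[ m_0(1,n_1,\ldots,n_r)=\max_{\mathcal D\in\mathfrak D_r}\ \sum_{X\in\mathcal D}a_X . \]
   Context: Write $[r]=\{1,\ldots,r\}$. Let $X_1,\ldots,X_r$ be finite sets with $|X_i|=n_i$. A family $\mathcal F\subseteq X_1\times\cdots\times X_r$ is viewed as an $r$-partite $r$-graph with (disjoint) parts $X_1,\ldots,X_r$: a tuple $(x_1,\ldots,x_r)$ is the edge whose vertices are $x_1\in X_1,\ldots,x_r\in X_r$, so two tuples $\mathbf x,\mathbf y$ are disjoint edges if and only if $x_i\ne y_i$ for all $i\in[r]$. Let $\nu(\mathcal F)$ be the maximum number of pairwise disjoint edges in $\mathcal F$, and $\tau(\mathcal F)$ the minimum size of a vertex set meeting every edge of $\mathcal F$. The number $m_0(1,n_1,\ldots,n_r)$ is the maximum size of a family $\mathcal F\subseteq X_1\times\cdots\times X_r$ satisfying $\nu(\mathcal F)\le 1<\tau(\mathcal F)$; equivalently, any two members of $\mathcal F$ agree in at least one coordinate, and no vertex is common to all members of $\mathcal F$. Put $a_i:=n_i-1$ for $i\in[r]$, and for $X\subseteq[r]$ put $a_X:=\prod_{i\in X}a_i$, with $a_\emptyset:=1$. A family $\mathcal D\subseteq 2^{[r]}$ is called available if: (D1) $\mathcal D$ is a downset, i.e. $X\in\mathcal D$ and $Y\subseteq X$ imply $Y\in\mathcal D$; (D2) $\bigcup_{X\in\mathcal D}X=[r]$; (D3) $X\cup Y\ne[r]$ for all $X,Y\in\mathcal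 D$. $\mathfrak D_r$ denotes the collection of all available families $\mathcal D\subseteq 2^{[r]}$. *)

(* Defs.v *)
From mathcomp Require Import all_boot.

Set Implicit Arguments.
Unset Strict Implicit.
Unset Printing Implicit Defensive.

Section PartiteFamilies.

Variables (r : nat) (X : 'I_r -> finType).

(* Elements of X_1 * ... * X_r. *)
Definition edge : finType := {dffun forall i : 'I_r, X i}.

(* The tagged sum makes the parts X_i disjoint, even when X i = X j. *)
Definition vertex : finType := {i : 'I_r & X i}.

Definition edge_vertices (x : edge) : {set vertex} :=
  [set Tagged X (x i) | i : 'I_r].

Definition matching (M : {set edge}) : bool :=
  [forall x in M, forall y in M,
     (x != y) ==> [disjoint edge_vertices x & edge_vertices y]].

Definition nu (F : {set edge}) : nat :=
  \max_(M : {set edge} | (M \subset F) && matching M) #|M|.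

Definition vertex_cover (F : {set edge}) (V : {set vertex}) : bool :=
  [forall x in F, ~~ [disjoint edge_vertices x & V]].

(* For 0 < r the set of all vertices is a cover, so the minimum is over a
   nonempty range. *)
Definition tau (F : {set edge}) : nat :=
  #|[arg min_(V < [set: vertex] | vertex_cover F V) #|V|]|.

(* An empty \max is 0; for s = 1, 3 <= r and all #|X i| >= 2 the range is not
   empty: take the tuples agreeing with a fixed tuple in at least two of the
   first three coordinates. *)
Definition m0 (s : nat) : nat :=
  \max_(F : {set edge} | nu F <= s < tau F) #|F|.

End PartiteFamilies.

Section AvailableFamilies.

Variable r : nat.

Definition downset (D : {set {set 'I_r}}) : bool :=
  [forall A in D, forall B : {set 'I_r}, (B \subset A) ==> (B \in D)].

(* For 3 <= r the sets of size at most 1 form an available family. *)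
Definition available (D : {set {set 'I_r}}) : bool :=
  [&& downset D,
      \bigcup_(A in D) A == [set: 'I_r]
    & [forall A in D, forall B in D, A :|: B != [set: 'I_r]]].

Definition aprod (n : 'I_r -> nat) (A : {set 'I_r}) : nat :=
  \prod_(i in A) (n i - 1).

End AvailableFamilies.

(* Main.v *)
Require Import Defs.
From mathcomp Require Import all_boot.

(** Fix a tuple [o] and let [supp x] be the set of coordinates where [x] differs
    from [o]; the sum attached to [D] counts the tuples with support in [D], and
    these tuples form a nontrivial intersecting family when [D] is available.

    Conversely, among the nontrivial intersecting families of a given size take
    one, [F], of minimal total support size. The shift replacing the value [a]
    by [o i] at coordinate [i] preserves intersection, so if it moves [F] it
    destroys nontriviality. Hence each coordinate [i] is either stable (resetting
    [x i] to [o i] keeps [x] in [F]) or bad: [F] takes only [o i] and one other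
    value there, and resetting a member leaves [F]. With no bad coordinate the
    supports of [F] form an available family; exactly one is impossible. With
    exactly two, [p] and [q], each determines the other, so we may erase [q],
    then shift at [p], and add [[set q]] to the supports. With three or
    more, pick three and take all sets containing at most one of these. *)

Set Implicit Arguments.
Unset Strict Implicit.
Unset Printing Implicit Defensive.

(** * Intersecting families and resetting coordinates to [o] *)

Section Shifting.

Variables (r : nat) (X : 'I_r -> finType).
Implicit Types (F G : {set edge X}) (x y : edge X) (i j : 'I_r).
Implicit Types (A B K : {set 'I_r}).

(** Agreement is restricted to [K] because, once a coordinate [q] has been erased, all members agree
    there and only agreement on [[set~ q]] carries information. *)
Definition intersecting_on K F :=
  [forall x in F, forall y in F, exists i in K, x i == y i].

Definition nontrivial F :=
  [forall v : vertex X, exists x in F, x (tag v) != tagged v].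

Lemma intersecting_onP K F :
  reflect {in F &, forall x y, exists2 i, i \in K & x i = y i}
          (intersecting_on K F).
Proof.
apply: (iffP forall_inP) => [FK x y Fx Fy | FK x Fx].
  have /exists_inP[i Ki /eqP] := forall_inP (FK x Fx) y Fy.
  by exists i.
apply/forall_inP=> y Fy; have [i Ki /eqP exy] := FK x y Fx Fy.
by apply/exists_inP; exists i.
Qed.

Lemma nontrivialP F :
  reflect (forall i (v : X i), exists2 x, x \in F & x i != v) (nontrivial F).
Proof.
apply: (iffP forallP) => ntF => [i v | [i v]]; last exact/exists_inP/ntF.
by have /exists_inP := ntF (Tagged X v).
Qed.

Variable o : edge X.

Definition zero A x : edge X := [ffun i => if i \in A then o i else x i].

Definition supp x := [set i | x i != o i].

Definition stable F i := [forall x in F, zero [set i] x \in F].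

Lemma zeroE A x i : zero A x i = if i \in A then o i else x i.
Proof. by rewrite ffunE. Qed.

Lemma zero1 i x j : j != i -> zero [set i] x j = x j.
Proof. by rewrite zeroE inE => /negPf->. Qed.

Lemma zero1_id i x : x i = o i -> zero [set i] x = x.
Proof. by move=> xi; apply/ffunP=> j; rewrite zeroE inE; case: eqP => // ->. Qed.

Lemma zeroC A B x : zero A (zero B x) = zero B (zero A x).
Proof. by apply/ffunP=> i; rewrite !zeroE; do 2!case: (i \in _). Qed.

Lemma eq_zero1 i x y :
  zero [set i] x = zero [set i] y <-> forall j, j != i -> x j = y j.
Proof.
split=> [/ffunP exy j ji | exy]; first by have:= exy j; rewrite !zero1.
by apply/ffunP=> j; rewrite !zeroE inE; case: eqVneq => // /exy.
Qed.

Lemma supp_zero A x : supp (zero A x) = supp x :\: A.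
Proof. by apply/setP=> i; rewrite !inE zeroE; case: ifP; rewrite ?eqxx. Qed.

Lemma stableP F i x : stable F i -> x \in F -> zero [set i] x \in F.
Proof. by move/forall_inP; apply. Qed.

Lemma zero_stable F A x :
  {in A, forall i, stable F i} -> x \in F -> zero A x \in F.
Proof.
move=> stA Fx; rewrite -[A]set_enum.
have {stA}: {in enum A, forall i, stable F i}.
  by move=> i; rewrite mem_enum; apply: stA.
elim: (enum A) => [_ | i s IHs sts].
  by rewrite (_ : zero _ x = x) //; apply/ffunP=> j; rewrite zeroE inE.
have -> : zero [set j in i :: s] x = zero [set i] (zero [set j in s] x).
  by apply/ffunP=> j; rewrite !zeroE !inE; case: eqVneq => // ->.
apply: stableP; first by apply: sts; rewrite mem_head.
by apply: IHs => j sj; apply: sts; rewrite inE sj orbT.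
Qed.

(** * Shifts *)

Definition shift_elt F i (a : X i) x :=
  if (x i == a) && (zero [set i] x \notin F) then zero [set i] x else x.

Definition shift F i (a : X i) := shift_elt F a @: F.

Lemma shift_elt_other F i (a : X i) x j :
  j != i -> shift_elt F a x j = x j.
Proof. by rewrite /shift_elt; case: ifP => // _; apply: zero1. Qed.

(** A moved image lies outside [F] and an unmoved one inside, so the two kinds never collide; two
    moved members share the value [a] at [i]. *)
Lemma shift_elt_inj F i (a : X i) : {in F &, injective (shift_elt F a)}.
Proof.
move=> x y Fx Fy; rewrite /shift_elt.
case: ifP => [/andP[/eqP xa Fx0] | _]; case: ifP => [/andP[/eqP ya Fy0] | _] //.
- move/eq_zero1 => exy; apply/ffunP=> j.
  by case: (eqVneq j i) => [-> | /exy //]; rewrite xa ya.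
- by move=> exy; rewrite exy Fy in Fx0.
- by move=> exy; rewrite -exy Fx in Fy0.
Qed.

Lemma card_shift F i (a : X i) : #|shift F a| = #|F|.
Proof. exact/card_in_imset/shift_elt_inj. Qed.

(** If only [x] moves, its agreement with [y] can be lost only at [i], where both equal [a]. Then
    [y] stays because its reset is in [F], and [x] agrees with that reset at a coordinate other than
    [i], since [x i] is not [o i]. *)
Lemma intersecting_shift K F i (a : X i) :
  intersecting_on K F -> intersecting_on K (shift F a).
Proof.
move=> /intersecting_onP FK.
have main x y : x \in F -> y \in F -> x i = a -> zero [set i] x \notin F ->
    (y i = a -> zero [set i] y \in F) ->
  exists2 j, j \in K & zero [set i] x j = y j.
  move=> Fx Fy xa Fx0 Fy0; have [j Kj exy] := FK x y Fx Fy.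
  have [eji | ji] := eqVneq j i; last by exists j; rewrite ?zero1.
  subst j; have {}Fy0 := Fy0 (etrans (esym exy) xa).
  have [k Kk] := FK _ _ Fx Fy0; have [eki | ki] := eqVneq k i; last first.
    by rewrite zero1 // => exyk; exists k; rewrite ?zero1.
  by subst k; rewrite zeroE set11 => /zero1_id xi; rewrite xi Fx in Fx0.
apply/intersecting_onP=> _ _ /imsetP[x Fx ->] /imsetP[y Fy ->].
rewrite /shift_elt; case: ifP => [/andP[/eqP xa Fx0] | Fx0].
  case: ifP => [_ | Fy0].
    by have [j Kj exy] := FK x y Fx Fy; exists j; rewrite // !zeroE exy.
  by apply: main => // ya; move: Fy0; rewrite ya eqxx => /negbFE.
case: ifP => [/andP[/eqP ya Fy0] | _]; last exact: FK.
have [xa | j Kj eyx] := main y x Fy Fx ya Fy0; last by exists j.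
by move: Fx0; rewrite xa eqxx => /negbFE.
Qed.

Lemma shift_elt_id F i (a : X i) x :
  zero [set i] x \in F \/ x i != a -> shift_elt F a x = x.
Proof. by rewrite /shift_elt => -[-> | /negPf->] //; rewrite andbF. Qed.

Lemma mem_shift F i (a : X i) x :
  x \in F -> zero [set i] x \in F \/ x i != a -> x \in shift F a.
Proof. by move=> Fx /shift_elt_id xE; apply/imsetP; exists x. Qed.

Lemma zero_mem_shift F i (a : X i) x :
  x \in F -> x i = a -> zero [set i] x \in shift F a.
Proof.
move=> Fx xa; have [Fx0 | Fx0] := boolP (zero [set i] x \in F).
  by apply: mem_shift => //; left; rewrite zero1_id // zeroE set11.
by apply/imsetP; exists x; rewrite // /shift_elt xa eqxx Fx0.
Qed.

Lemma stable_shift_other F i (a : X i) j :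
  j != i -> stable F j -> stable (shift F a) j.
Proof.
move=> ji stF; apply/forall_inP=> _ /imsetP[x Fx ->].
have ij : i != j by rewrite eq_sym.
have Fxj := stableP stF Fx; rewrite /shift_elt.
case: ifP => [/andP[/eqP xa _] | Fx0].
  by rewrite zeroC; apply: zero_mem_shift; rewrite ?zero1.
apply: mem_shift => //; rewrite zero1 // zeroC.
have [xa | _] := eqVneq (x i) a; [left | by right].
by move: Fx0; rewrite xa eqxx /= => /negbFE; apply: stableP.
Qed.

(** A single shift suffices because [a] is the only value besides [o i] in use at [i]. *)
Lemma stable_shift F i (a : X i) :
  {in F, forall x, x i != o i -> x i = a} -> stable (shift F a) i.
Proof.
move=> F2; apply/forall_inP=> _ /imsetP[x Fx ->].
rewrite /shift_elt; case: ifP => [/andP[/eqP xa _] | Fx0].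
  by rewrite zero1_id ?zeroE ?set11 //; apply: zero_mem_shift.
have [xo | xo] := eqVneq (x i) (o i); last exact: zero_mem_shift (F2 x Fx xo).
rewrite zero1_id //; apply: mem_shift; rewrite // zero1_id //; by left.
Qed.

(** * Bad coordinates and families of minimal weight *)

Definition bad F i := exists a : X i, a != o i /\
  {in F, forall x, x i != o i -> x i = a /\ zero [set i] x \notin F}.

(** Distinct members agreeing off [i] would have the values [a] and [o i] there, so one would be the
    reset of the other, which badness forbids. *)
Lemma bad_eq F i x y :
  bad F i -> x \in F -> y \in F -> (forall j, j != i -> x j = y j) -> x = y.
Proof.
move=> [a [_ Fa]] Fx Fy exy.
have {}exy : zero [set i] x = zero [set i] y by apply/eq_zero1.
have [/zero1_id xo | /(Fa x Fx)[xa Fx0]] := eqVneq (x i) (o i).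
  have [/zero1_id yo | /(Fa y Fy)[_]] := eqVneq (y i) (o i).
    by rewrite -xo exy.
  by rewrite -exy xo Fx.
have [/zero1_id yo | /(Fa y Fy)[ya _]] := eqVneq (y i) (o i).
  by rewrite exy yo Fy in Fx0.
apply/ffunP=> j; have [-> | ji] := eqVneq j i; first by rewrite xa ya.
by move/eq_zero1: exy => /(_ j ji).
Qed.

Definition weight F := \sum_(x in F) #|supp x|.

Lemma weight_shift F i x :
  x \in F -> zero [set i] x \notin F -> weight (shift F (x i)) < weight F.
Proof.
move=> Fx Fx0; rewrite /weight big_imset /=; last exact: shift_elt_inj.
rewrite (bigD1 x) //= [ltnRHS](bigD1 x) //= -addSn leq_add //.
  rewrite /shift_elt eqxx Fx0 supp_zero; apply/proper_card/properD1.
  by rewrite inE; apply: contraNneq Fx0 => /zero1_id->.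
apply: leq_sum => y _; rewrite /shift_elt; case: ifP => // _.
by rewrite supp_zero subset_leq_card ?subD1set.
Qed.

(* A shift that is not the identity lowers the weight, so at an [F] of minimal
   weight it has to produce a star, and then the star has centre [o i]. *)
Lemma stable_or_bad F :
    intersecting_on setT F -> nontrivial F ->
    (forall G, intersecting_on setT G -> nontrivial G -> #|G| = #|F| ->
       weight F <= weight G) ->
  forall i, stable F i \/ bad F i.
Proof.
move=> FI ntF Fmin i; case: (boolP (stable F i)) => [|stF]; [by left | right].
have /exists_inP[x Fx Fx0] : [exists x in F, zero [set i] x \notin F].
  by rewrite -negb_forall_in.
have /forallPn[[j v] /exists_inPn/= star] : ~~ nontrivial (shift F (x i)).
  apply/negP=> ntS.
  have := Fmin _ (intersecting_shift (x i) FI) ntS (card_shift _ _).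
  by rewrite leqNgt weight_shift.
have {}star y : y \in F -> shift_elt F (x i) y j = v.
  by move=> Fy; apply/eqP; rewrite -[_ == _]negbK star // imset_f.
have [eji | ji] := eqVneq j i; last first.
  move/nontrivialP: ntF => /(_ j v)[y Fy /eqP[]].
  by rewrite -(star y Fy) shift_elt_other.
subst j; exists (x i); split.
  by apply: contraNneq Fx0 => /zero1_id->.
move=> y Fy yo; move: (star y Fy); rewrite -(star x Fx) /shift_elt eqxx Fx0 /=.
case: ifP => [/andP[/eqP ya ->] // | _]; rewrite zeroE set11 => yo'.
by rewrite yo' eqxx in yo.
Qed.

(** * Families given by their supports *)

Definition fam (D : {set {set 'I_r}}) := [set x | supp x \in D].

Lemma sub_fam_supp F : F \subset fam (supp @: F).
Proof. by apply/subsetP=> x Fx; rewrite inE imset_f. Qed.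

(** The tuples with support [A] form a product of choices: [n i - 1] values at each [i] in [A], and
    only [o i] elsewhere. *)
Lemma card_fam (n : 'I_r -> nat) D :
  (forall i, #|X i| = n i) -> #|fam D| = \sum_(A in D) aprod n A.
Proof.
move=> Xn; rewrite -sum1_card (partition_big supp [in D]) /=; last first.
  by move=> x; rewrite inE.
apply: eq_bigr => A DA; rewrite sum1_card.
pose f i : pred (X i) := if i \in A then predC1 (o i) else pred1 (o i).
transitivity #|(family f : simpl_pred (edge X))|.
  apply: eq_card => x; rewrite [LHS]inE inE.
  apply/andP/familyP => [[_ /eqP xA] i | fx].
    by rewrite /f -xA inE; case: ifP => // /negbFE.
  have {fx} xA : supp x = A.
    apply/setP=> i; have := fx i; rewrite /f inE.
    by case: ifP; rewrite inE => _ // /eqP ->; rewrite eqxx.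
  by rewrite xA DA eqxx.
rewrite card_family foldrE big_image /= /aprod [RHS]big_mkcond /=.
apply: eq_bigr => i _; rewrite /f; case: ifP => _; last exact: card1.
by rewrite cardC1 Xn subn1.
Qed.

Lemma availableP (D : {set {set 'I_r}}) :
  reflect [/\ forall A B, A \in D -> B \subset A -> B \in D,
              forall i, exists2 A, A \in D & i \in A
            & {in D &, forall A B, A :|: B != setT}]
          (available D).
Proof.
apply: (iffP and3P) => [[dD cD uD] | [dD cD uD]]; split.
- by move=> A B DA; apply/implyP; have /forallP := forall_inP dD A DA.
- by move=> i; apply/bigcupP; rewrite (eqP cD).
- by move=> A B DA DB; apply: (forall_inP (forall_inP uD A DA)).
- by apply/forall_inP=> A DA; apply/forallP=> B; apply/implyP/dD.
- rewrite -subTset; apply/subsetP=> i _; exact/bigcupP.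
- by apply/forall_inP=> A DA; apply/forall_inP=> B; apply: uD.
Qed.

(** * Families stable at every coordinate *)

Section Stable.

Variable G : {set edge X}.
Hypothesis stG : forall i, stable G i.

Lemma supp_down A B : A \in supp @: G -> B \subset A -> B \in supp @: G.
Proof.
case/imsetP=> x Gx -> sB; apply/imsetP; exists (zero (~: B) x).
  exact: zero_stable.
by rewrite supp_zero setDE setCK; apply/esym/setIidPr.
Qed.

(* Zeroing [y] on the support of [x] makes [x] and [y] differ wherever one of
   them is nonzero. *)
Lemma supp_cross K x y :
  intersecting_on K G -> x \in G -> y \in G -> ~~ (K \subset supp x :|: supp y).
Proof.
move=> /intersecting_onP GK Gx Gy; apply/negP=> /subsetP Kxy.
have /(GK x _ Gx)[i Ki] : zero (supp x) y \in G by apply: zero_stable.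
rewrite zeroE inE; have := Kxy i Ki; rewrite !inE.
by case: (eqVneq (x i)) => [-> /= yo | xo _] => [/esym/eqP | /eqP]; apply/negP.
Qed.

Lemma stable_available :
  intersecting_on setT G -> nontrivial G -> available (supp @: G).
Proof.
move=> GI /nontrivialP ntG; apply/availableP; split; first exact: supp_down.
  move=> i; have [x Gx xo] := ntG i (o i).
  by exists (supp x); rewrite ?imset_f ?inE.
by move=> _ _ /imsetP[x Gx ->] /imsetP[y Gy ->]; rewrite -subTset supp_cross.
Qed.

End Stable.

(** * One or two bad coordinates *)

Lemma bad_nonunique F p :
  nontrivial F -> bad F p -> ~ (forall i, i != p -> stable F i).
Proof.
move=> /nontrivialP ntF [a [ao Fa]] stF.
have [x Fx xo] := ntF p (o p); have [xa _] := Fa x Fx xo.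
have [y Fy ya] := ntF p a.
have yo : y p = o p by apply/eqP; apply: contraNT ya => /(Fa y Fy)[-> _].
have zF z : z \in F -> zero [set~ p] z \in F.
  by apply: zero_stable => i; rewrite !inE; apply: stF.
have zp z : zero [set~ p] z p = z p by rewrite zeroE !inE eqxx.
(* Resetting [zero [set~ p] x] at [p] as well yields [zero [set~ p] y], a member of [F]; badness at
   [p] forbids this. *)
have [|_ /negP[]] := Fa _ (zF x Fx); first by rewrite zp.
suff -> : zero [set p] (zero [set~ p] x) = zero [set~ p] y by apply: zF.
apply/ffunP=> i; rewrite !zeroE !inE; by case: eqVneq => // ->.
Qed.

Lemma bad_pair F p q :
    intersecting_on setT F -> nontrivial F ->
    p != q -> bad F p -> bad F q ->
    (forall i, i != p -> i != q -> stable F i) ->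
  exists2 D, available D & #|F| <= #|fam D|.
Proof.
move=> /intersecting_onP FI /nontrivialP ntF pq bp bq stF.
pose A := ~: [set p; q].
have zF z : z \in F -> zero A z \in F.
  by apply: zero_stable => i; rewrite !inE negb_or => /andP[]; apply: stF.
(* With the stable coordinates reset, members agreeing at [q] differ at most at [p], so badness at
   [p] makes them agree there too. *)
have qp_eq x y : x \in F -> y \in F -> x q = y q -> x p = y p.
  move=> Fx Fy exy; have := bad_eq bp (zF x Fx) (zF y Fy).
  move=> /(_ _)/ffunP/(_ p); rewrite !zeroE !inE eqxx; apply=> i ip.
  by rewrite !zeroE !inE (negPf ip); case: eqVneq => //= ->.
have pq_eq x y : x \in F -> y \in F -> x p = y p -> x q = y q.
  move=> Fx Fy exy; have := bad_eq bq (zF x Fx) (zF y Fy).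
  move=> /(_ _)/ffunP/(_ q); rewrite !zeroE !inE eqxx orbT; apply=> i iq.
  by rewrite !zeroE !inE (negPf iq) orbF; case: eqVneq => //= ->.
pose G0 := zero [set q] @: F; have [a [ao Fa]] := bp.
have G0zF z : z \in F -> zero [set q] z \in G0 by apply: imset_f.
have stG0 i : i != p -> stable G0 i.
  move=> ip; apply/forall_inP=> _ /imsetP[x Fx ->].
  have [-> | iq] := eqVneq i q; first by rewrite zero1_id ?zeroE ?set11 ?G0zF.
  by rewrite zeroC G0zF //; apply: stableP => //; apply: stF.
(* An agreement at [q] is erased, but by [qp_eq] it comes with one at [p]. *)
have G0I : intersecting_on [set~ q] G0.
  apply/intersecting_onP=> _ _ /imsetP[x Fx ->] /imsetP[y Fy ->].
  have [i _ exy] := FI x y Fx Fy; have [eiq | iq] := eqVneq i q.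
    by exists p; rewrite ?inE // !zero1 //; apply: qp_eq; rewrite // -eiq.
  by exists i; rewrite ?inE // !zero1.
(* Only [o p] and [a] occur at [p], so this shift makes [p] stable and keeps the other coordinates
   stable. *)
pose G := shift G0 a.
have GI : intersecting_on [set~ q] G by apply: intersecting_shift.
have stG i : stable G i.
  have [-> | ip] := eqVneq i p; last by apply/stable_shift_other/stG0.
  apply: stable_shift => _ /imsetP[x Fx ->]; rewrite zero1 // => xo.
  by have [] := Fa x Fx xo.
have Gq x : x \in G -> x q = o q.
  case/imsetP=> _ /imsetP[z Fz ->] ->.
  by rewrite shift_elt_other 1?eq_sym // zeroE set11.
have sG i z : i != p -> i != q -> z \in F ->
    exists2 y, y \in G & y i = z i.
  move=> ip iq Fz; exists (shift_elt G0 a (zero [set q] z)).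
    by rewrite imset_f ?G0zF.
  by rewrite shift_elt_other // zero1.
(* Every member of [G] equals [o] at [q], so [[set q]] is added to cover [q]. *)
exists ([set q] |: supp @: G); last first.
  have <- : #|G| = #|F|.
    rewrite card_shift card_in_imset // => x y Fx Fy /eq_zero1.
    exact: bad_eq bq Fx Fy.
  rewrite subset_leq_card //; apply: subset_trans (sub_fam_supp G) _.
  by apply/subsetP=> x; rewrite !inE => ->; rewrite orbT.
have [x Fx xo] := ntF p (o p); have [xa _] := Fa x Fx xo.
have [y Fy ya] := ntF p a.
have yo : y p = o p by apply/eqP; apply: contraNT ya => /(Fa y Fy)[-> _].
(* This tuple has support [[set p]]. The shift leaves it in place because its reset at [p], which is
   [o], already lies in [G0]. *)
have Gu : zero [set q] (zero A x) \in G.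
  apply: mem_shift; first exact/G0zF/zF.
  left; suff -> : zero [set p] (zero [set q] (zero A x)) = zero [set q] (zero A y).
    exact/G0zF/zF.
  apply/ffunP=> i; rewrite !zeroE !inE.
  by case: (eqVneq i p) => [-> | _]; [rewrite (negPf pq) | case: (i == q)].
apply/availableP; split.
- move=> B C /setU1P[-> | DB] sCB; rewrite in_setU1; last first.
    by rewrite (supp_down stG DB) ?orbT.
  move: sCB; rewrite subset1 => /orP[/eqP-> | /eqP->]; first by rewrite eqxx.
  by rewrite (supp_down stG (imset_f _ Gu)) ?sub0set ?orbT.
- move=> i; have [-> | iq] := eqVneq i q.
    by exists [set q]; rewrite ?inE ?eqxx.
  have [-> | ip] := eqVneq i p.
    exists (supp (zero [set q] (zero A x))); first by rewrite inE imset_f ?orbT.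
    by rewrite inE zero1 // zeroE !inE eqxx.
  have [z Fz zo] := ntF i (o i); have [t Gt tz] := sG i z ip iq Fz.
  by exists (supp t); rewrite inE ?tz // imset_f ?orbT.
(* Since [G] intersects off [q], no single support contains [[set~ q]]. *)
- have supp1 t : t \in G -> [set q] :|: supp t != setT.
    move=> Gt; apply: contra (supp_cross stG GI Gt Gt) => /eqP qt.
    apply/subsetP=> i; have := in_setT i; rewrite -qt !inE => /orP[-> | ->] //.
  move=> _ _ /setU1P[-> | /imsetP[t Gt ->]] /setU1P[-> | /imsetP[v Gv ->]].
  - apply/negP=> /eqP/setP/(_ p); rewrite !inE (negPf pq) //.
  - exact: supp1.
  - by rewrite setUC; apply: supp1.
  apply/negP=> /eqP/setP/(_ q); by rewrite !inE !Gq // eqxx.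
Qed.

(** * A tuple [w] nowhere equal to [o], and three bad coordinates *)

Variable w : edge X.
Hypothesis wo : forall i, w i != o i.

Lemma supp_zero_w A : supp (zero (~: A) w) = A.
Proof.
by apply/setP=> i; rewrite !inE zeroE !inE; case: (i \in A); rewrite ?wo ?eqxx.
Qed.

(* [F] takes two values at each of [p], [q], [s], and by badness at [p] at most
   four of the eight resulting patterns occur over a given rest; these are
   injected into the patterns with at most one nonzero entry. *)
Lemma bad_triple F p q s :
    p != q -> q != s -> s != p -> bad F p -> bad F q -> bad F s ->
  exists2 D, available D & #|F| <= #|fam D|.
Proof.
move=> pq qs sp bp [b [bo Fb]] [c [co Fc]].
pose T := [set p; q; s].
have cT : #|T| = 3.
  by rewrite /T setUC cardsU1 cards2 pq !inE negb_or sp eq_sym qs.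
exists [set A : {set 'I_r} | #|A :&: T| <= 1].
  apply/availableP; split.
  - move=> A B; rewrite !inE => DA sBA; apply: leq_trans DA.
    exact/subset_leq_card/setSI.
  - move=> i; exists [set i]; rewrite inE // -(cards1 i).
    exact/subset_leq_card/subsetIl.
  move=> A B; rewrite !inE => DA DB; apply/eqP=> AB.
  have := leq_trans (leq_card_setU (A :&: T) (B :&: T)) (leq_add DA DB).
  by rewrite -setIUl AB setTI cT.
(* If [q] and [s] are both nonzero, the nonzero entry is moved to [p] alone; otherwise resetting [p]
   leaves at most one nonzero entry in [T]. *)
pose f x : edge X := if (x q != o q) && (x s != o s)
  then [ffun j => if j == p then w j else zero [set q; s] x j]
  else zero [set p] x.
(* The value at [p] tells the two cases apart. In the first, the erased values must be [b] and [c],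
   so in both cases all coordinates but [p] are recovered, and [bad_eq] gives [p]. *)
have f_inj : {in F &, injective f}.
  move=> x y Fx Fy fxy; apply: (bad_eq bp) => // j jp; move: fxy; rewrite /f.
  have ps : p != s by rewrite eq_sym.
  case: ifP => [/andP[xq xs] | _]; case: ifP => [/andP[yq ys] | _] /ffunP fxy.
  - have := fxy j; rewrite !ffunE (negPf jp) !inE.
    have [-> _ | _] := eqVneq j q.
      by rewrite (Fb x Fx xq).1 (Fb y Fy yq).1.
    have [-> _ | //] := eqVneq j s.
    by rewrite (Fc x Fx xs).1 (Fc y Fy ys).1.
  - by have /eqP := fxy p; rewrite !ffunE eqxx set11 (negPf (wo p)).
  - by have /eqP := fxy p; rewrite !ffunE eqxx set11 eq_sym (negPf (wo p)).
  by have := fxy j; rewrite !zero1.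
rewrite -(card_in_imset f_inj) subset_leq_card //; apply/subsetP.
move=> _ /imsetP[x Fx ->]; rewrite !inE /f; case: ifP => [_ | /nandP xqs].
  rewrite -(cards1 p); apply/subset_leq_card/subsetP=> i.
  rewrite !inE ffunE; case: (eqVneq i p) => // _; rewrite zeroE !inE /=.
  by case: ifP; rewrite ?eqxx // andbF.
have xqs1 : exists2 i, i != p &
    forall j, x j != o j -> j \in T -> j != p -> j = i.
  case: xqs => /negPn/eqP xo.
    exists s => // j; rewrite !inE => xj /orP[/orP[/eqP-> | /eqP jq] | /eqP->] //.
      by rewrite eqxx.
    by rewrite jq xo eqxx in xj.
  exists q; first by rewrite eq_sym.
  move=> j; rewrite !inE => xj /orP[/orP[/eqP-> | /eqP->] | /eqP js] //.
    by rewrite eqxx.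
  by rewrite js xo eqxx in xj.
have [i ip xi] := xqs1; rewrite -(cards1 i); apply/subset_leq_card/subsetP=> j.
case/setIP; rewrite supp_zero => /setD1P[jp]; rewrite inE => xj Tj.
by rewrite inE (xi j xj Tj jp).
Qed.

Lemma nontrivial_intersecting_le F :
    intersecting_on setT F -> nontrivial F ->
  exists2 D, available D & #|F| <= #|fam D|.
Proof.
move=> FI ntF.
pose P G := [&& intersecting_on setT G, nontrivial G & #|G| == #|F|].
have PF : P F by rewrite /P FI ntF eqxx.
case: (arg_minnP weight PF) => G /and3P[GI ntG /eqP cG] Gmin {PF}; rewrite -cG.
have sb := stable_or_bad GI ntG.
have {}sb i : stable G i \/ bad G i.
  by apply: sb => H HI ntH cH; apply: Gmin; rewrite /P HI ntH cH cG /=.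
have nsb i : ~~ stable G i -> bad G i by case: (sb i) => // ->.
have [/forallP stG | /forallPn[p /nsb bp]] := boolP [forall i, stable G i].
  exists (supp @: G); first exact: stable_available.
  exact/subset_leq_card/sub_fam_supp.
have [/forall_inP stG | ] := boolP [forall (i | i != p), stable G i].
  by have := bad_nonunique ntG bp stG.
move/forall_inPn=> [q qp /nsb bq].
have [/forall_inP stG | ] := boolP [forall (i | (i != p) && (i != q)), stable G i].
  apply: (@bad_pair _ p q) => //; first by rewrite eq_sym.
  by move=> i ip iq; apply: stG; rewrite ip.
move/forall_inPn=> [s] /andP[sp sq] /nsb bs.
by apply: (@bad_triple _ p q s); rewrite // eq_sym.
Qed.

(** * Families arising from available [D] *)

Lemma intersecting_fam D : available D -> intersecting_on setT (fam D).
Proof.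
case/availableP=> _ _ uD; apply/intersecting_onP=> x y.
rewrite !inE => /uD/[apply]; rewrite -subTset => /subsetPn[i _].
by rewrite !inE negb_or !negbK => /andP[/eqP xo /eqP yo]; exists i; rewrite ?xo.
Qed.

(** The vertex [o i] is avoided by a tuple whose support contains [i], any other vertex by [o]
    itself, whose support is empty. *)
Lemma nontrivial_fam D : 0 < r -> available D -> nontrivial (fam D).
Proof.
move=> r0 /availableP[dD cD _]; apply/nontrivialP=> i v.
have [A DA iA] := cD i; have [-> | vo] := eqVneq v (o i).
  by exists (zero (~: A) w); rewrite ?inE ?supp_zero_w // zeroE !inE iA.
exists o; last by rewrite eq_sym.
rewrite inE; apply: dD DA _; apply/subsetP=> j; by rewrite inE eqxx.
Qed.

End Shifting.


(** * Matching number and covering number *)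

Section Numbers.

Variables (r : nat) (X : 'I_r -> finType).
Implicit Types (F M : {set edge X}) (x y : edge X).

Lemma mem_edge_vertices x (v : vertex X) :
  (v \in edge_vertices x) = (x (tag v) == tagged v).
Proof.
apply/imsetP/eqP => [[i _ ->] // |]; case: v => i a /= <-.
by exists i.
Qed.

Lemma disjoint_edges x y :
  [disjoint edge_vertices x & edge_vertices y] = [forall i, x i != y i].
Proof.
rewrite disjoint_subset; apply/subsetP/forallP => [dxy i | dxy [i a]].
  have := dxy (Tagged X (x i)).
  by rewrite inE !mem_edge_vertices /= eqxx eq_sym => ->.
rewrite inE !mem_edge_vertices /= => /eqP <-; rewrite eq_sym; exact: dxy.
Qed.

Lemma nu_le1 F : 0 < r -> (nu F <= 1) = intersecting_on setT F.
Proof.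
move=> r0; apply/bigmax_leqP/intersecting_onP => [nuF x y Fx Fy | FI M].
  (* An edge agrees with itself somewhere only because [0 < r]. *)
  have [-> | nxy] := eqVneq x y; first by exists (Ordinal r0).
  suff : ~~ [disjoint edge_vertices x & edge_vertices y].
    by rewrite disjoint_edges => /forallPn[i /negPn/eqP xy]; exists i.
  apply/negP=> dxy; suff /nuF : ([set x; y] \subset F) && matching [set x; y].
    by rewrite cards2 nxy.
  rewrite subUset !sub1set Fx Fy /=.
  apply/forall_inP=> a /set2P a_xy; apply/forall_inP=> b /set2P b_xy.
  apply/implyP; case: a_xy b_xy => -> [] ->; rewrite ?eqxx // => _.
  by rewrite disjoint_sym.
case/andP=> sMF mM; apply/card_le1_eqP=> x y Mx My; apply/esym/eqP/negPn/negP=> nxy.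
have [i _ xyi] := FI x y (subsetP sMF x Mx) (subsetP sMF y My).
have := forall_inP (forall_inP mM x Mx) y My; rewrite nxy disjoint_edges.
by move/forallP/(_ i); rewrite xyi eqxx.
Qed.

Lemma vertex_cover1 F (v : vertex X) :
  vertex_cover F [set v] = [forall x in F, x (tag v) == tagged v].
Proof.
apply: eq_forallb_in => x _; rewrite disjoint_sym disjoints1 negbK.
exact: mem_edge_vertices.
Qed.

(** A cover with at most one vertex extends to a singleton cover, that is, a vertex common to all
    members; [v0] serves to enlarge the empty cover. *)
Lemma tau_gt1 F (v0 : vertex X) : 0 < r -> (1 < tau F) = nontrivial F.
Proof.
move=> r0; have coverT : vertex_cover F [set: vertex X].
  apply/forall_inP=> x _; apply/pred0Pn; exists (Tagged X (x (Ordinal r0))).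
  by rewrite /= inE mem_edge_vertices eqxx.
rewrite /tau; case: (arg_minnP (fun V : {set vertex X} => #|V|) coverT) => V VF Vmin.
apply/idP/forallP => [V1 v | ntF].
  have : ~~ vertex_cover F [set v].
    by apply/negP=> /Vmin; rewrite cards1 leqNgt V1.
  by rewrite vertex_cover1 negb_forall_in.
have ncover1 v : ~~ vertex_cover F [set v].
  by rewrite vertex_cover1 negb_forall_in; apply: ntF.
have mono (U W : {set vertex X}) : U \subset W -> vertex_cover F U -> vertex_cover F W.
  move=> sUW /forall_inP UF; apply/forall_inP=> x /UF; apply: contra.
  by rewrite ![[disjoint edge_vertices x & _]]disjoint_sym; apply: disjointWl.
rewrite ltnNge; apply/negP=> /card_le1_eqP V1.
have [V0 | [v Vv]] := set_0Vmem V.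
  by have /negP[] := ncover1 v0; apply: mono VF; rewrite V0 sub0set.
have /negP[] := ncover1 v; apply: mono VF; apply/subsetP=> u Vu.
by rewrite inE (V1 u v).
Qed.

End Numbers.

Theorem theorem1p2 (r : nat) (n : 'I_r -> nat) (X : 'I_r -> finType)
    (hr : 3 <= r) (hn : forall i : 'I_r, 2 <= n i)
    (hX : forall i : 'I_r, #|X i| = n i) :
  m0 X 1 =
    \max_(D : {set {set 'I_r}} | available D) \sum_(A in D) aprod n A.
Proof.
have r0 : 0 < r by apply: ltn_trans hr.
have oP i : exists a : X i, true.
  have /card_gt0P[a _] : 0 < #|X i| by rewrite hX ltnW.
  by exists a.
pose o : edge X := [ffun i => xchoose (oP i)].
(* Here [2 <= n i] provides a second value in each part. *)
have wP i : exists a : X i, a != o i.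
  have /card_gt0P[a ao] : 0 < #|predC1 (o i)| by rewrite cardC1 hX -subn1 subn_gt0.
  by exists a.
pose w : edge X := [ffun i => xchoose (wP i)].
have wo i : w i != o i by rewrite ffunE; apply: xchooseP (wP i).
have m0E (F : {set edge X}) :
    (nu F <= 1 < tau F) = intersecting_on setT F && nontrivial F.
  by rewrite nu_le1 // (tau_gt1 _ (Tagged X (o (Ordinal r0)))).
apply/eqP; rewrite eqn_leq; apply/andP; split; apply/bigmax_leqP.
  move=> F; rewrite m0E => /andP[FI ntF].
  have [D avD] := nontrivial_intersecting_le wo FI ntF.
  by rewrite (card_fam _ _ hX) => /leq_trans; apply; apply: leq_bigmax_cond.
move=> D avD; rewrite -(card_fam o _ hX).
by apply: leq_bigmax_cond; rewrite m0E intersecting_fam // (nontrivial_fam wo).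
Qed.
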